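(* Let $N\ge 1$ and let $L_1,L_2\in\mathbb{R}^{N\times N}$ be weighted, directed graph Laplacians such that the graph underlying $L_1$ and the graph underlying $L_2$ each contain a connected spanning tree. Consider the second-order serial consensus system $$(sI+L_2)(sI+L_1)X(s)=U_{\mathrm{ref}}(s),$$ where $U_{\mathrm{ref}}\in\mathcal{RH}_\infty$ (an $N$-vector). Then: (i) the poles of the system are given by the union of the eigenvalues of $-L_1$ and of $-L_2$; (ii) its solution achieves second-order consensus, i.e. for all $i,j\in\{1,\dots,N\}$, $$\lim_{t\to\infty}\left|\frac{\mathrm{d}x_i(t)}{\mathrm{d}t}-\frac{\mathrm{d}x_j(t)}{\mathrm{d}t}\right|=0\quad\text{and}\quad \lim_{t\to\infty}|x_i(t)-x_j(t)|=0 .$$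
   Context: Graph Laplacian: a matrix $L\in\mathbb{R}^{N\times N}$ is a (weighted, directed) graph Laplacian if there are weights $w_{i,j}\ge 0$ with $[L]_{i,j}=-w_{i,j}$ for $i\ne j$ and $[L]_{i,i}=\sum_{k\ne i}w_{i,k}$. The underlying graph has vertex set $\mathcal V=\{1,\dots,N\}$ and an edge for each pair $(i,j)$, $i\neq j$, with $w_{i,j}>0$; such an edge is regarded as directed from $j$ to $i$ (agent $i$ uses the state of agent $j$). The graph contains a connected spanning tree if there is a vertex $r$ from which there is a directed path to every other vertex. (Consequently $0$ is a simple eigenvalue of $L$ and all other eigenvalues lie in the open right half plane.) $\mathcal{RH}_\infty$ is the space of proper, real rational, stable transfer matrices (all poles in the open left half plane). The system in the time domain is $\ddot x(t)=u_{\mathrm{ref}}(t)-(L_2+L_1)\dot x(t)-L_2L_1x(t)$ with $x(t)=(x_1(t),\dots,x_N(t))^T\in\mathbb{R}^N$, where $X$ and $U_{\mathrm{ref}}$ are the Laplace transforms of $x$ and $u_{\mathrm{ref}}$, and the initial conditions $x(0),\dot x(0)$ are arbitrary. With $\xi_1=x$, $\xi_2=\dot x+L_1x$ it has the state-space form $$\begin{bmatrix}\dot\xi_1\\ \dot\xi_2\end{bmatrix}=A\begin{bmatrix}\xi_1\\ \xi_2\end{bmatrix}+\begin{bmatrix}0\\ u_{\mathrm{ref}}\end{bmatrix},\qquad A=\begin{bmatrix}-L_1&I\\0&-L_2\end{bmatrix}.$$ The poles of the system are the eigenvalues of $A$. *)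

(* Defs.v *)
From HB Require Import structures.
From mathcomp Require Export all_boot all_order all_algebra.
From mathcomp Require Export complex.
From mathcomp Require Export all_classical all_reals all_analysis.
Export Order.TTheory GRing.Theory Num.Theory numFieldNormedType.Exports.

Set Implicit Arguments.
Unset Strict Implicit.
Unset Printing Implicit Defensive.

Local Open Scope classical_set_scope.
Local Open Scope ring_scope.
Local Open Scope complex_scope.

(* The diagonal entries of the weight matrix [W] are irrelevant. *)
Definition is_laplacian (R : realType) (N : nat) (W L : 'M[R]_N) : Prop :=
  [/\ forall i j : 'I_N, i != j -> 0 <= W i j,
      forall i j : 'I_N, i != j -> L i j = - W i j
    & forall i : 'I_N, L i i = \sum_(k | k != i) W i k].

(* [W i j > 0] is an edge from [j] to [i]: agent [i] uses the state of [j]. *)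
Definition graph_edge (R : realType) (N : nat) (W : 'M[R]_N) : rel 'I_N :=
  fun j i => (i != j) && (0 < W i j).

Definition has_spanning_tree (R : realType) (N : nat) (W : 'M[R]_N) : Prop :=
  exists r : 'I_N, forall i : 'I_N, connect (graph_edge W) r i.

Definition complex_mx (R : realType) (m n : nat) (A : 'M[R]_(m, n)) :
  'M[R[i]]_(m, n) := map_mx (real_complex R) A.

Definition complex_poly (R : realType) (p : {poly R}) : {poly R[i]} :=
  map_poly (real_complex R) p.

Definition is_eigenvalue (R : realType) (n : nat) (A : 'M[R]_n) (z : R[i]) :
  bool := eigenvalue (complex_mx A) z.

(* Transfer matrices are total functions on the complex plane, whose values at
   their (finitely many) poles are irrelevant.  Each entry is written in lowest
   terms [p / q], so that its poles are exactly the roots of [q]. *)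
Definition RHinf (R : realType) (m n : nat) (G : R[i] -> 'M[R[i]]_(m, n)) :
  Prop :=
  forall i j, exists p q : {poly R},
    [/\ coprimep p q,
        (size p <= size q)%N,
        forall s : R[i], root (complex_poly q) s -> complex.Re s < 0
      & forall s : R[i], ~~ root (complex_poly q) s ->
          G s i j = (complex_poly p).[s] / (complex_poly q).[s]].

(* Integral of [e^{-st} f(t)] over [t >= 0]; with [s = a + ib],
   [e^{-st} = e^{-at} (cos (bt) - i sin (bt))]. *)
Definition laplace (R : realType) (f : R -> R) (s : R[i]) : R[i] :=
  let a := complex.Re s in
  let b := complex.Im s in
  Rintegral lebesgue_measure `[0, +oo[
    (fun t => expR (- (a * t)) * cos (b * t) * f t)
  -i* Rintegral lebesgue_measure `[0, +oo[
    (fun t => expR (- (a * t)) * sin (b * t) * f t).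

(* A proper transfer function need not vanish at infinity, hence the inverse
   transform of [U] is in general a distribution [d delta_0 + u], with [u] an
   ordinary function (continuous for [t > 0]: the usual representative of the
   inverse transform of a strictly proper rational function).  Its transform is
   [d] plus that of [u], required to converge absolutely on some right
   half-plane. *)
Definition has_laplace_transform (R : realType) (N : nat)
    (d : 'cV[R]_N) (u : R -> 'cV[R]_N) (U : R[i] -> 'cV[R[i]]_N) : Prop :=
  forall i : 'I_N,
    (forall t : R, 0 < t -> {for t, continuous (fun r : R => u r i 0)}) /\
    (exists a : R, forall s : R[i], a < complex.Re s ->
       lebesgue_measure.-integrable `[0, +oo[
         (fun t : R => (expR (- (complex.Re s * t)) * u t i 0)%:E) /\
       U s i 0 = (d i 0)%:C + laplace (fun t => u t i 0) s).

Definition dot (R : realType) (N : nat) (x : R -> 'cV[R]_N) (t : R) :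
  'cV[R]_N := \col_i derive1 (fun r : R => x r i 0) t.

Definition derivable_at (R : realType) (N : nat) (x : R -> 'cV[R]_N) (t : R) :
  Prop := forall i : 'I_N, derivable (fun r : R => x r i 0) t 1.

(* [x] solves [x'' = u_ref - (L2 + L1) x' - L2 L1 x] for the input
   [u_ref = d delta_0 + u], where [x0] and [v0] are the initial position and
   velocity just before time 0.  The impulse makes the velocity jump by [d]. *)
Definition serial_solution (R : realType) (N : nat) (L1 L2 : 'M[R]_N)
    (d : 'cV[R]_N) (u : R -> 'cV[R]_N) (x0 v0 : 'cV[R]_N)
    (x : R -> 'cV[R]_N) : Prop :=
  [/\ forall t : R, 0 < t -> derivable_at x t /\ derivable_at (dot x) t,
      forall t : R, 0 < t ->
        dot (dot x) t = u t - (L2 + L1) *m dot x t - (L2 *m L1) *m x t,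
      forall i : 'I_N, x t i 0 @[t --> 0^'+] --> x0 i 0
    & forall i : 'I_N, dot x t i 0 @[t --> 0^'+] --> v0 i 0 + d i 0].

(* State matrix in the coordinates [xi1 = x], [xi2 = x' + L1 x]; its
   eigenvalues are, by definition, the poles of the system. *)
Definition serial_state_matrix (R : realType) (N : nat) (L1 L2 : 'M[R]_N) :
  'M[R]_(N + N) := block_mx (- L1) 1%:M 0 (- L2).

Definition serial_pole (R : realType) (N : nat) (L1 L2 : 'M[R]_N) (z : R[i]) :
  bool := is_eigenvalue (serial_state_matrix L1 L2) z.

Definition second_order_consensus (R : realType) (N : nat)
    (x : R -> 'cV[R]_N) : Prop :=
  forall i j : 'I_N,
    (`|dot x t i 0 - dot x t j 0| @[t --> +oo] --> (0 : R)) /\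
    (`|x t i 0 - x t j 0| @[t --> +oo] --> (0 : R)).

(* Main.v *)
(* In the coordinates [xi1 = x], [xi2 = x' + L1 x] the system is a cascade:
   [xi2' = - L2 xi2 + u], then [xi1' = - L1 xi1 + xi2].  The state matrix is
   block triangular, whence the poles.  For consensus, the differences
   [y i = x i - x r] to the root of a spanning tree obey [y' = M y + h] with
   the spectrum of [M] in the open left half plane (Gershgorin, plus the
   maximum principle along the tree for the eigenvalue 0); after Schur
   triangularization, scalar equations with decaying forcing have decaying
   solutions.  Applied to [L2] and then to [L1], this shows that consensus only
   requires [u] to vanish at infinity, whatever the initial state.  That [u]
   does so is read off its transform: partial fractions give a combination [g]
   of the functions [t^m e^(l t)], [Re l < 0], with the same transform up to a
   constant, and [u = g] on [t > 0] by uniqueness of the Laplace transform. *)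
Require Import Defs.
From mathcomp Require Import ring lra measurable_realfun.

Set Implicit Arguments.
Unset Strict Implicit.
Unset Printing Implicit Defensive.

Local Open Scope classical_set_scope.
Local Open Scope ring_scope.

(** * Decay of solutions of forced linear equations *)

Section Decay.
Context {R : realType}.

Lemma cvg_expRN (a : R) : 0 < a -> expR (- (a * t)) @[t --> +oo] --> 0.
Proof.
move=> a0; apply: (@cvg_comp _ _ _ (fun t => a * t) (fun t => expR (- t)) _ +oo).
  exact: gt0_cvgMry.
exact: cvgr_expR.
Qed.

(** Gronwall's argument with the integrating factor [expR (a * t)]: once [|k|] stays below
    [a * (e / 2)], the function [expR (a * t) * (V t - e / 2)] is nonincreasing, so [V] is at most
    [e / 2] plus a decaying exponential. *)
Lemma decay_ineq (V V' k : R -> R) (a : R) : 0 < a ->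
  (forall t : R, 0 < t -> is_derive t 1 V (V' t)) ->
  (forall t : R, 0 < t -> V' t <= - a * V t + k t) ->
  (forall t : R, 0 < t -> 0 <= V t) ->
  k t @[t --> +oo] --> 0 -> V t @[t --> +oo] --> 0.
Proof.
move=> a0 dV leV V0 k0; apply/cvgr0Pnorm_lt => e e0.
have [T [_ HT]] : \forall t \near +oo, `|k t| < a * (e / 2).
  by move/cvgr0Pnorm_lt : k0; apply; rewrite mulr_gt0 ?divr_gt0.
pose T1 := `|T| + 1.
have T1T : T < T1 by rewrite /T1 ltr_pwDr// ler_norm.
have T10 : 0 < T1 by rewrite /T1 ltr_pwDr.
pose F t := expR (a * t) * (V t - e / 2).
have dF (t : R) : 0 < t ->
    is_derive t 1 F (expR (a * t) * (a * (V t - e / 2) + V' t)).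
  move=> t0; have := dV _ t0 => ?.
  by apply: is_derive_eq; rewrite /GRing.scale/=; ring.
have decF (t : R) : T1 <= t -> F t <= F T1.
  move=> T1t; apply: (@ler0_derive1_nincry _ F T1) => //.
  - move=> y; rewrite in_itv/= andbT => Ty.
    exact: (@ex_derive _ _ _ _ _ _ _ (dF y (lt_trans T10 Ty))).
  - move=> y; rewrite in_itv/= andbT => Ty; have y0 := lt_trans T10 Ty.
    rewrite derive1E (@derive_val _ _ _ _ _ _ _ (dF y y0)).
    rewrite pmulr_rle0 ?expR_gt0//.
    have := leV y y0; have := HT y (lt_trans T1T Ty).
    rewrite ltr_norml => /andP[_]; lra.
  - apply: derivable_within_continuous => y; rewrite in_itv/= andbT => Ty.
    exact: (@ex_derive _ _ _ _ _ _ _ (dF y (lt_le_trans T10 Ty))).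
have e2 : 0 < e / 2 by rewrite divr_gt0.
have /cvgr0Pnorm_lt cF : expR (- (a * t)) * F T1 @[t --> +oo] --> 0.
  rewrite -(mul0r (F T1)); apply: cvgM; last exact: cvg_cst.
  exact: cvg_expRN.
have {cF} H := cF _ e2.
near=> t.
have T1t : T1 <= t by near: t; apply: nbhs_pinfty_ge; rewrite num_real.
have t0 : 0 < t by apply: lt_le_trans T1t.
rewrite ger0_norm ?V0//.
have h : `|expR (- (a * t)) * F T1| < e / 2 by near: t.
have := decF _ T1t; rewrite {1}/F.
rewrite -(ler_pM2l (expR_gt0 (- (a * t)))) mulrA -expRD addrC subrr expR0 mul1r.
move: h; rewrite ltr_norml => /andP[_]; lra.
Unshelve. all: by end_near. Qed.

(** This is [z' = l z + h] for [z = z1 + i z2], with the Lyapunov function [V = |z|^2]. Half of the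
    damping [2 a V] absorbs the forcing, which leaves [V' <= a V + |h|^2 / (- a)]. *)
Lemma decay_pair (l : R[i]) (z1 z2 h1 h2 : R -> R) : complex.Re l < 0 ->
  (forall t : R, 0 < t -> is_derive t 1 z1
     (complex.Re l * z1 t - complex.Im l * z2 t + h1 t)) ->
  (forall t : R, 0 < t -> is_derive t 1 z2
     (complex.Im l * z1 t + complex.Re l * z2 t + h2 t)) ->
  h1 t @[t --> +oo] --> 0 -> h2 t @[t --> +oo] --> 0 ->
  z1 t @[t --> +oo] --> 0 /\ z2 t @[t --> +oo] --> 0.
Proof.
case: l => [a b] /= a0 d1 d2 c1 c2.
have V0 : (z1 t ^+ 2 + z2 t ^+ 2) @[t --> +oo] --> 0.
  apply: (@decay_ineq _ (fun t => 2 * (a * (z1 t ^+ 2 + z2 t ^+ 2) +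
      z1 t * h1 t + z2 t * h2 t)) (fun t => (h1 t ^+ 2 + h2 t ^+ 2) / (- a)) (- a)).
  - by rewrite oppr_gt0.
  - move=> t t0; have := d1 _ t0 => ?; have := d2 _ t0 => ?.
    by apply: is_derive_eq; rewrite /GRing.scale/=; ring.
  - move=> t t0; have na : 0 < - a by rewrite oppr_gt0.
    (* Young's inequality by completing the square; the weight [- a] is what the damping can
       spare. *)
    have amgm x y : 2 * (x * y) <= - a * x ^+ 2 + y ^+ 2 / (- a).
      rewrite -subr_ge0.
      have -> : - a * x ^+ 2 + y ^+ 2 / - a - 2 * (x * y) =
        (- a * x - y) ^+ 2 / (- a) by field; rewrite ?lt_eqF.
      by rewrite divr_ge0// ?sqr_ge0// ltW.
    have := amgm (z1 t) (h1 t); have := amgm (z2 t) (h2 t).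
    rewrite mulrDl opprK; lra.
  - by move=> t _; rewrite addr_ge0// sqr_ge0.
  - rewrite (_ : 0 = (0 ^+ 2 + 0 ^+ 2) / (- a)); last by rewrite expr0n/= addr0 mul0r.
    apply: cvgM; last exact: cvg_cst.
  apply: cvgD; rewrite !expr2; exact: cvgM.
have sq (z w : R -> R) : (forall t, z t ^+ 2 <= w t) -> w t @[t --> +oo] --> 0 ->
    z t @[t --> +oo] --> 0.
  move=> zw w0; apply/cvgr0Pnorm_lt => e e0.
  move/cvgr0Pnorm_lt : w0 => /(_ (e ^+ 2)); rewrite exprn_gt0// => /(_ isT) H.
  near=> t; rewrite -(@ltr_pXn2r _ 2)// ?nnegrE ?ltW// real_normK ?num_real//.
  apply: le_lt_trans (zw t) _; apply: le_lt_trans (ler_norm _) _.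
  by near: t.
split; apply: sq V0 => t; by rewrite ?lerDl ?lerDr sqr_ge0.
Unshelve. all: by end_near. Qed.

End Decay.

(** * Complex-valued functions of real time and linear systems with stable spectrum *)

Section ComplexValued.
Context {R : realType}.
Local Notation C := R[i]%type.
Local Notation Re := complex.Re.
Local Notation Im := complex.Im.

Lemma ReD (x y : C) : Re (x + y) = Re x + Re y. Proof. by case: x y => ? ? []. Qed.
Lemma ImD (x y : C) : Im (x + y) = Im x + Im y. Proof. by case: x y => ? ? []. Qed.
Lemma ReN (x : C) : Re (- x) = - Re x. Proof. by case: x. Qed.
Lemma ImN (x : C) : Im (- x) = - Im x. Proof. by case: x. Qed.
Lemma ReM (x y : C) : Re (x * y) = Re x * Re y - Im x * Im y.
Proof. by case: x y => ? ? []. Qed.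
Lemma ImM (x y : C) : Im (x * y) = Re x * Im y + Im x * Re y.
Proof. by case: x y => ? ? []. Qed.

Definition is_cderive (w : R -> C) (t : R) (dw : C) : Prop :=
  is_derive t 1 (fun r => Re (w r)) (Re dw) /\
  is_derive t 1 (fun r => Im (w r)) (Im dw).

Definition vanishes (w : R -> C) : Prop :=
  Re (w t) @[t --> +oo] --> 0 /\ Im (w t) @[t --> +oo] --> 0.

Lemma is_cderiveD (v w : R -> C) t dv dw :
  is_cderive v t dv -> is_cderive w t dw ->
  is_cderive (fun r => v r + w r) t (dv + dw).
Proof.
move=> [v1 v2] [w1 w2]; split.
  by under eq_fun do rewrite ReD; apply: is_derive_eq; rewrite ReD.
by under eq_fun do rewrite ImD; apply: is_derive_eq; rewrite ImD.
Qed.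

Lemma is_cderiveZ (c : C) (w : R -> C) t dw :
  is_cderive w t dw -> is_cderive (fun r => c * w r) t (c * dw).
Proof.
move=> [w1 w2]; split.
  by under eq_fun do rewrite ReM; apply: is_derive_eq; rewrite ReM.
by under eq_fun do rewrite ImM; apply: is_derive_eq; rewrite ImM.
Qed.

Lemma is_cderive_real (f : R -> R) (t df : R) :
  is_derive t 1 f df -> is_cderive (fun r => (f r)%:C%C) t df%:C%C.
Proof. by move=> f1; split => //=; exact: is_derive_cst. Qed.

Lemma is_cderive_sum (I : Type) (r : seq I) (w : I -> R -> C) t dw :
  (forall i, is_cderive (w i) t (dw i)) ->
  is_cderive (fun s => \sum_(i <- r) w i s) t (\sum_(i <- r) dw i).
Proof.
move=> wi; elim: r => [|i r IH].
  rewrite big_nil; under eq_fun do rewrite big_nil.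
  by split => /=; exact: is_derive_cst.
rewrite big_cons; under eq_fun do rewrite big_cons.
exact: is_cderiveD.
Qed.

Lemma vanishesD (v w : R -> C) :
  vanishes v -> vanishes w -> vanishes (fun r => v r + w r).
Proof.
move=> [v1 v2] [w1 w2]; split; rewrite -(addr0 0).
  by under eq_fun do rewrite ReD; exact: cvgD.
by under eq_fun do rewrite ImD; exact: cvgD.
Qed.

Lemma vanishesZ (c : C) (w : R -> C) :
  vanishes w -> vanishes (fun r => c * w r).
Proof.
move=> [w1 w2]; have cvg0 (a b : R) (f g : R -> R) : f t @[t --> +oo] --> 0 ->
    g t @[t --> +oo] --> 0 -> a * f t + b * g t @[t --> +oo] --> 0.
  move=> f0 g0; rewrite (_ : 0 = a * 0 + b * 0); last by rewrite !mulr0 addr0.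
  by apply: cvgD; apply: cvgM => //; exact: cvg_cst.
split.
  by under eq_fun do rewrite ReM -mulNr; exact: cvg0.
by under eq_fun do rewrite ImM; exact: cvg0.
Qed.

Lemma vanishes_real (f : R -> R) :
  f t @[t --> +oo] --> 0 -> vanishes (fun r => (f r)%:C%C).
Proof. by move=> f0; split => //=; exact: cvg_cst. Qed.

Lemma vanishes_sum (I : Type) (r : seq I) (P : pred I) (w : I -> R -> C) :
  (forall i, P i -> vanishes (w i)) ->
  vanishes (fun s => \sum_(i <- r | P i) w i s).
Proof.
move=> wi; elim: r => [|i r IH].
  rewrite (_ : (fun _ => _) = fun=> 0); last by apply/funext => s; rewrite big_nil.
  by split => /=; exact: cvg_cst.
rewrite (_ : (fun _ => _) = fun s => if P i then w i s + \sum_(j <- r | P j) w j s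
    else \sum_(j <- r | P j) w j s); last by apply/funext => s; rewrite big_cons.
move: (wi i); case: (P i) => [/(_ isT) wvi|_] //; exact: vanishesD.
Qed.

Lemma vanishes_ode (l : C) (z h : R -> C) : Re l < 0 ->
  (forall t : R, 0 < t -> is_cderive z t (l * z t + h t)) ->
  vanishes h -> vanishes z.
Proof.
move=> l0 dz [h1 h2]; apply: (decay_pair l0 _ _ h1 h2) => t /dz[dz1 dz2].
  by move: dz1; rewrite ReD ReM.
by move: dz2; rewrite ImD ImM [Re l * _ + _]addrC.
Qed.

Lemma eigenvalue_trig (n : nat) (P A : 'M[C]_n) (i : 'I_n) : P \in unitmx ->
  is_trig_mx (conjmx P A) -> eigenvalue A (conjmx P A i i).
Proof.
move=> uP tA.
apply: (@eigenvalue_conjmx _ _ _ P A); rewrite ?stablemx_unit ?row_free_unit//.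
rewrite [_ \in _]eigenvalue_root_char char_poly_trig// /root horner_prod.
by rewrite (bigD1 i)//= !hornerE subrr mul0r.
Qed.

(** In Schur coordinates [z = P y] the matrix is lower triangular, so [z i] solves a scalar equation
    with rate [T i i], an eigenvalue of [M], forced by [g i] and by the [z j] with [j < i]. *)
Lemma vanishing_system (n : nat) (M : 'M[R]_n) (y h : R -> 'cV[R]_n) :
  (forall l, is_eigenvalue M l -> Re l < 0) ->
  (forall t : R, 0 < t -> forall i,
     is_derive t 1 (fun r => y r i 0) ((M *m y t + h t) i 0)) ->
  (forall i, h t i 0 @[t --> +oo] --> 0) ->
  forall i, y t i 0 @[t --> +oo] --> 0.
Proof.
case: n M y h => [|n] M y h HM dy h0; first by case.
have [P /unitarymx_unit uP] := Schur (complex_mx M) (ltn0Sn n).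
rewrite /similar_to; set T := conjmx P _ => trigT.
have PM : P *m complex_mx M = T *m P by rewrite /T conjumx// mulmxKV.
pose z i t := (P *m complex_mx (y t)) i 0.
pose g i t := (P *m complex_mx (h t)) i 0.
have zE i t : z i t = \sum_j P i j * (y t j 0)%:C%C.
  by rewrite /z mxE; apply: eq_bigr => j _; rewrite mxE.
have gE i t : g i t = \sum_j P i j * (h t j 0)%:C%C.
  by rewrite /g mxE; apply: eq_bigr => j _; rewrite mxE.
have dz i t : 0 < t -> is_cderive (z i) t
    (T i i * z i t + (\sum_(j < n.+1 | (j < i)%N) T i j * z j t + g i t)).
  move=> t0; have -> : T i i * z i t +
      (\sum_(j < n.+1 | (j < i)%N) T i j * z j t + g i t) =
      \sum_j P i j * ((M *m y t + h t) j 0)%:C%C.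
    transitivity ((P *m complex_mx (M *m y t + h t)) i 0); last first.
      by rewrite mxE; apply: eq_bigr => j _; rewrite [in LHS]mxE.
    rewrite /complex_mx map_mxD map_mxM mulmxDr mulmxA PM -mulmxA [in RHS]mxE addrA.
    congr (_ + _); rewrite [in RHS]mxE [RHS](bigD1 i)//=; congr (_ + _).
    rewrite [RHS](bigID (fun j : 'I__ => (j < i)%N))/= [X in _ = _ + X]big1 ?addr0.
      by apply: eq_bigl => j; rewrite andbC -val_eqE/=; case: ltngtP.
    move=> j /andP[ji]; rewrite -leqNgt leq_eqVlt eq_sym => /orP[ij|ij].
      by case/negP: ji; rewrite -val_eqE.
    by move/is_trig_mxP : trigT => ->//; rewrite mul0r.
  rewrite (funext (zE i)); apply: is_cderive_sum => j; apply: is_cderiveZ.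
  exact/is_cderive_real/dy.
have vz i : vanishes (z i).
  (* Strong induction on the index: the coordinates before [i] already vanish at infinity and count
     as forcing. *)
  have [k] := ubnP (i : nat); elim: k i => // k IH i ik.
  apply: vanishes_ode (dz i) _; first exact/HM/eigenvalue_trig.
  apply: vanishesD.
    apply: vanishes_sum => j ji; apply: vanishesZ; apply: IH.
    exact: leq_trans ji _.
  rewrite (funext (gE i)); apply: vanishes_sum => j _; apply: vanishesZ.
  exact: vanishes_real.
move=> i; suff : vanishes (fun t => (y t i 0)%:C%C) by case.
have -> : (fun t => (y t i 0)%:C%C) = fun t => \sum_j invmx P i j * z j t.
  apply/funext => t.
  have -> : (y t i 0)%:C%C = (invmx P *m (P *m complex_mx (y t))) i 0.
    by rewrite mulKmx// mxE.
  by rewrite mxE.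
by apply: vanishes_sum => j _; apply: vanishesZ.
Qed.

End ComplexValued.

(** * Graph Laplacians *)

Section Laplacian.
Context {R : realType} (N : nat) (W L : 'M[R]_N).
Hypothesis LW : is_laplacian W L.
Local Notation C := R[i]%type.
Local Notation Re := complex.Re.
Local Notation Im := complex.Im.

Lemma laplacian_weight_ge0 (i k : 'I_N) : k != i -> 0 <= W i k.
Proof. by case: LW => W0 _ _; rewrite eq_sym; exact: W0. Qed.

(** The rows of [L] sum to zero, so only differences of entries matter. The morphism [f] covers real
    and complex vectors at once. *)
Lemma laplacian_sumE (S : comNzRingType) (f : {rmorphism R -> S}) (v : 'cV[S]_N) i :
  (map_mx f L *m v) i 0 = \sum_(k | k != i) f (W i k) * (v i 0 - v k 0).
Proof.
case: LW => _ Lo Ld; rewrite mxE (bigD1 i)//= mxE Ld rmorph_sum mulr_suml.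
rewrite -big_split/=; apply: eq_bigr => k ki.
by rewrite mxE Lo 1?eq_sym// rmorphN; ring.
Qed.

Lemma laplacian_sumE_real (v : 'cV[R]_N) i :
  (L *m v) i 0 = \sum_(k | k != i) W i k * (v i 0 - v k 0).
Proof. by have := laplacian_sumE idfun v i; rewrite map_mx_id. Qed.

(** At an index where [v] is maximal, every term [W i k * (v i 0 - v k 0)] is nonnegative. *)
Lemma laplacian_const_ge0 (v : 'cV[R]_N) (c : R) : (0 < N)%N ->
  (forall i, (L *m v) i 0 = c) -> 0 <= c.
Proof.
move=> N0 Lv; pose i0 := Ordinal N0.
case: (@arg_maxP _ _ _ i0 xpredT (fun i => v i 0)) => // m _ max_m.
rewrite -(Lv m) laplacian_sumE_real; apply: sumr_ge0 => k km.
by rewrite mulr_ge0 ?laplacian_weight_ge0// subr_ge0; exact: max_m.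
Qed.

(** Maximum principle: where [v] attains its maximum, a vanishing sum of nonnegative terms forces
    the same value at the tail of every incoming edge. Following a path from [r] to a maximizer
    backwards carries the maximum to [r]. *)
Lemma laplacian_harmonic_le (v : 'cV[R]_N) (r : 'I_N) :
  (forall i, connect (graph_edge W) r i) ->
  (forall i, (L *m v) i 0 = 0) -> forall i, v i 0 <= v r 0.
Proof.
move=> tree Lv i.
case: (@arg_maxP _ _ _ i xpredT (fun i => v i 0)) => // m _ max_m.
suff -> : v r 0 = v m 0 by exact: max_m.
have [p + mE] := connectP (tree m); rewrite {}mE in max_m *.
elim: p r {tree} max_m => //= j p IH r max_m /andP[/andP[jr Wjr] pj].
have vj := IH j max_m pj; rewrite -vj; move: (Lv j).
rewrite laplacian_sumE_real; have nneg k : k != j -> 0 <= W j k * (v j 0 - v k 0).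
  by move=> kj; rewrite mulr_ge0 ?laplacian_weight_ge0// subr_ge0 vj max_m.
move/eqP; rewrite psumr_eq0// => /allP/(_ r); rewrite mem_index_enum => /(_ isT).
by rewrite eq_sym jr/= mulf_eq0 gt_eqF//= subr_eq0 => /eqP.
Qed.

(** The sign lemma for [v] and [- v] gives [c = 0]; the maximum principle for both then bounds
    [v i 0] from both sides. *)
Lemma laplacian_harmonic (v : 'cV[R]_N) (r : 'I_N) (c : R) :
  (forall i, connect (graph_edge W) r i) ->
  (forall i, (L *m v) i 0 = c) -> forall i, v i 0 = v r 0.
Proof.
move=> tree Lv i; have N0 : (0 < N)%N by apply: leq_ltn_trans (ltn_ord i).
have LNv j : (L *m (- v)) j 0 = - c by rewrite mulmxN mxE Lv.
have c0 : c = 0.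
  apply/eqP; rewrite eq_le (laplacian_const_ge0 N0 Lv) andbT.
  by rewrite -oppr_ge0 (laplacian_const_ge0 N0 LNv).
apply/eqP; rewrite eq_le; apply/andP; split.
  by apply: laplacian_harmonic_le => // j; rewrite Lv.
rewrite -lerN2; have := @laplacian_harmonic_le (- v) r tree _ i.
by rewrite !mxE; apply => j; rewrite LNv c0 oppr0.
Qed.

(* Gershgorin's disc at an entry of largest modulus. *)
Lemma laplacian_eigenvalue (w : 'cV[C]_N) (l : C) : w != 0 -> l != 0 ->
  complex_mx L *m w = l *: w -> 0 < Re l.
Proof.
move=> w0 l0 Lw.
have [i0 _] : exists i, w i 0 != 0.
  apply/existsP; apply: contraR w0; rewrite negb_exists => /forallP w0.
  apply/eqP/colP => i; rewrite mxE; apply/eqP; have := w0 i.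
  by rewrite negbK.
have normE z : `|z| = (Re `|z|)%:C%C :> C by rewrite RRe_real// normr_real.
case: (@arg_maxP _ _ _ i0 xpredT (fun i => Re `|w i 0|)) => // m _ max_m.
have {}max_m k : `|w k 0| <= `|w m 0| by rewrite normE [leRHS]normE lecR; exact: max_m.
have wm : 0 < `|w m 0|.
  rewrite normr_gt0; apply: contraNneq w0 => wm0; apply/eqP/colP => k.
  rewrite mxE; apply/eqP; rewrite -normr_le0.
  by apply: le_trans (max_m k) _; rewrite wm0 normr0.
pose D := \sum_(k | k != m) W m k.
have D0 : 0 <= D by apply: sumr_ge0 => k; exact: laplacian_weight_ge0.
(* Row [m] of the eigenvalue equation reads [(D - l) w_m = \sum_k W m k w_k], and no [|w_k|] exceeds
   [|w_m|]. *)
have : `|D%:C%C - l| <= D%:C%C.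
  rewrite -(ler_pM2r wm) -normrM.
  have -> : (D%:C%C - l) * w m 0 = \sum_(k | k != m) (W m k)%:C%C * w k 0.
    have : (complex_mx L *m w) m 0 = l * w m 0 by rewrite Lw mxE.
    rewrite laplacian_sumE mulrBl => <-.
    rewrite rmorph_sum mulr_suml -sumrB; apply: eq_bigr => k _ /=; ring.
  rewrite rmorph_sum mulr_suml; apply: le_trans (ler_norm_sum _ _ _) _.
  apply: ler_sum => k km; rewrite normrM ger0_norm ?ler0c ?laplacian_weight_ge0//.
  by rewrite ler_wpM2l ?ler0c ?laplacian_weight_ge0.
case: l l0 {Lw} => a b l0 /=.
have -> : D%:C%C - (a +i* b)%C = ((D - a) -i* b)%C by rewrite /real_complex_def; simpc.
rewrite normc_def lecR/= => h.
have : (D - a) ^+ 2 + (- b) ^+ 2 <= D ^+ 2.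
  rewrite -ler_sqrt ?sqr_ge0//; apply: le_trans h _.
  by rewrite sqrtr_sqr ger0_norm.
(* The disc of centre [D] and radius [D] meets the closed left half plane at most in 0: [a <= 0]
   would force [a = b = 0]. *)
rewrite ltNge => h2; apply/negP => a0; case/negP: l0.
have a2 := sqr_ge0 a; have b2 := sqr_ge0 b.
have Da : 0 <= D * - a by rewrite mulr_ge0// oppr_ge0.
have /eqP : a ^+ 2 = 0 by nra.
have /eqP : b ^+ 2 = 0 by nra.
by rewrite !sqrf_eq0 eq_complex/= => /eqP-> /eqP->; rewrite eqxx.
Qed.

End Laplacian.

(** * Consensus of a Laplacian flow, through differences to the root *)

Section Consensus.
Context {R : realType}.
Local Notation C := R[i]%type.
Local Notation Re := complex.Re.
Local Notation Im := complex.Im.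

(** [eigenvalue] speaks of row vectors; transposing inside the determinant yields a column
    eigenvector. *)
Lemma right_eigenvector (F : fieldType) (n : nat) (A : 'M[F]_n) (l : F) :
  eigenvalue A l -> exists2 v : 'cV[F]_n, v != 0 & A *m v = l *: v.
Proof.
move=> /eigenvalueP[u uA u0].
have /det0P[v v0 vA] : \det (A - l%:M)^T == 0.
  rewrite det_tr; apply/det0P; exists u => //.
  by rewrite mulmxBr uA mul_mx_scalar subrr.
exists v^T; first by rewrite trmx_eq0.
apply/eqP; rewrite -subr_eq0 -mul_scalar_mx -mulmxBl.
by rewrite -(trmxK (A - _)) -trmx_mul vA trmx0.
Qed.

(* On differences [x i - x r] the flow of [- L] acts through this matrix; the
   last term, invisible there since the difference at [r] is zero, moves the
   leftover eigenvalue [0] to [- 1]. *)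
Definition relative_mx (N : nat) (L : 'M[R]_N) (r : 'I_N) : 'M[R]_N :=
  \matrix_(i, j) (L r j - L i j - (j == r)%:R).

Lemma relative_mxE (S : nzRingType) (f : {rmorphism R -> S}) (N : nat)
    (L : 'M[R]_N) r (v : 'cV[S]_N) i :
  (map_mx f (relative_mx L r) *m v) i 0 =
    (map_mx f L *m v) r 0 - (map_mx f L *m v) i 0 - v r 0.
Proof.
rewrite !mxE -sumrB (bigD1 r)//= [in RHS](bigD1 r)//= !mxE eqxx.
rewrite !rmorphB rmorph1 !mulrBl mul1r [in RHS]addrAC; congr (_ + _).
by apply: eq_bigr => j /negPf jr; rewrite !mxE jr subr0 rmorphB mulrBl.
Qed.

Lemma relative_eigenvalue (N : nat) (W L : 'M[R]_N) (r : 'I_N) (l : C) :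
  is_laplacian W L -> (forall i, connect (graph_edge W) r i) ->
  is_eigenvalue (relative_mx L r) l -> Re l < 0.
Proof.
move=> LW tree /right_eigenvector[v v0 Mv].
pose c := (complex_mx L *m v) r 0.
have lv i : l * v i 0 = c - (complex_mx L *m v) i 0 - v r 0.
  have := relative_mxE (real_complex R) L r v i.
  rewrite -/(complex_mx _) -/(complex_mx _) Mv mxE => ->.
  by [].
(* Row [r] reads [l * v r 0 = - v r 0]: either [l = - 1] or [v] vanishes at [r]. *)
have [vr|vr] := eqVneq (v r 0) 0; last first.
  have : l * v r 0 = - 1 * v r 0 by rewrite lv subrr sub0r mulN1r.
  by move/(mulIf vr) => ->; rewrite /= ltrN10.
have Lv i : (complex_mx L *m v) i 0 = c - l * v i 0 by rewrite lv vr; ring.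
have [l0|l0] := eqVneq l 0.
  (* For [l = 0] the vector [L v] is constant, so the real and the imaginary part of [v] are each
     constant, equal to their value 0 at [r]; this contradicts [v != 0]. *)
  have harm (p : C -> R) : p 0 = 0 ->
      (forall i, (L *m \col_j p (v j 0)) i 0 = p c) -> forall i, p (v i 0) = 0.
    move=> p0 /(laplacian_harmonic LW tree) + i => /(_ i).
    by rewrite !mxE vr p0.
  case/negP: v0; apply/eqP/colP => i; rewrite [RHS]mxE.
  have Lvc j : (complex_mx L *m v) j 0 = c by rewrite Lv l0 mul0r subr0.
  have rev : forall i, Re (v i 0) = 0.
    apply: (harm (@complex.Re R)) => // j; rewrite -(Lvc j) !mxE.
    apply: (big_ind2 (fun (a : R) (b : C) => a = Re b)) => // [? x ? y -> ->|k _].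
      by case: x y => ? ? [].
    by rewrite !mxE; case: (v k 0) => a b /=; rewrite mul0r subr0.
  have imv : forall i, Im (v i 0) = 0.
    apply: (harm (@complex.Im R)) => // j; rewrite -(Lvc j) !mxE.
    apply: (big_ind2 (fun (a : R) (b : C) => a = Im b)) => // [? x ? y -> ->|k _].
      by case: x y => ? ? [].
    by rewrite !mxE; case: (v k 0) => a b /=; rewrite mul0r addr0.
  by apply/eqP; rewrite eq_complex rev imv !eqxx.
(* [L] kills constants, so [L v = c - l v] becomes [L w = - l w], and Gershgorin's bound applies to
   [- l]. *)
pose w := v - const_mx (c / l).
suff : 0 < Re (- l) by case: (l) => a b /=; rewrite oppr_gt0.
apply: (@laplacian_eigenvalue _ _ _ _ LW w); rewrite ?oppr_eq0//.
  apply: contraNneq v0 => w0; apply/eqP/colP => i; rewrite mxE -{}vr.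
  have wj j : w j 0 = v j 0 - c / l by rewrite !mxE.
  by apply: (addIr (- (c / l))); rewrite -!wj w0 !mxE.
apply/colP => i; rewrite mulmxBr mxE Lv [X in _ + X]mxE (laplacian_sumE LW).
rewrite big1 ?oppr0 ?addr0; last by move=> k _; rewrite !mxE subrr mulr0.
by rewrite !mxE; field.
Qed.

(** Only differences of the forcing are asked to vanish, because the second stage of the cascade is
    driven by a signal known merely to reach consensus. *)
Lemma relative_flow_vanishes (N : nat) (W L : 'M[R]_N) (xi h : R -> 'cV[R]_N) :
  is_laplacian W L -> has_spanning_tree W ->
  (forall t : R, 0 < t -> forall i,
     is_derive t 1 (fun r => xi r i 0) ((h t - L *m xi t) i 0)) ->
  (forall i j, h t i 0 - h t j 0 @[t --> +oo] --> 0) ->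
  forall i j, xi t i 0 - xi t j 0 @[t --> +oo] --> 0.
Proof.
move=> LW [r tree] dxi h0.
pose y t : 'cV_N := \col_i (xi t i 0 - xi t r 0).
pose k t : 'cV_N := \col_i (h t i 0 - h t r 0).
have y0 : forall i, y t i 0 @[t --> +oo] --> 0.
  apply: (@vanishing_system _ _ (relative_mx L r) y k).
  - by move=> l; exact: relative_eigenvalue LW tree.
  - move=> t t0 i.
    rewrite (_ : (fun _ => _) = fun s => xi s i 0 - xi s r 0); last first.
      by apply/funext => s; rewrite mxE.
    have := dxi t t0 i => ?; have := dxi t t0 r => ?; apply: is_derive_eq.
    (* [y] and [xi] differ by a constant vector, which [L] kills. *)
    have Ly j : (L *m y t) j 0 = (L *m xi t) j 0.
      rewrite !(laplacian_sumE_real LW); apply: eq_bigr => m _.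
      by rewrite !mxE; congr (_ * _); ring.
    have := relative_mxE idfun L r (y t) i; rewrite !map_mx_id// !Ly => My.
    by rewrite [RHS]mxE My !mxE; ring.
  - move=> i; rewrite (_ : (fun _ => _) = fun s => h s i 0 - h s r 0) //.
    by apply/funext => s; rewrite mxE.
move=> i j; rewrite (_ : (fun _ => _) = fun s => y s i 0 - y s j 0).
  by have yij := cvgB (y0 i) (y0 j); rewrite subr0 in yij; exact: yij.
by apply/funext => s; rewrite !mxE; ring.
Qed.

End Consensus.

(** * Uniqueness of the Laplace transform *)

Section LaplaceUniqueness.
Context {R : realType}.
Notation mu := (@lebesgue_measure R).
Local Notation halfline := (`[0%R, +oo[%classic : set R).

(** Integrability is bundled with the value, since [Rintegral] alone takes a value on every
    function. *)
Definition has_integral (A : set R) (f : R -> R) (c : R) : Prop :=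
  mu.-integrable A (EFin \o f) /\ Rintegral mu A f = c.

Lemma has_integralD (A : set R) f g c d : measurable (A : set (measurableTypeR R)) ->
  has_integral A f c -> has_integral A g d ->
  has_integral A (fun t => f t + g t) (c + d).
Proof.
move=> mA [fi <-] [gi <-]; split; last by rewrite RintegralD.
by have := integrableD mA fi gi; apply: eq_integrable.
Qed.

Lemma has_integralZ (A : set R) k f c : measurable (A : set (measurableTypeR R)) ->
  has_integral A f c -> has_integral A (fun t => k * f t) (k * c).
Proof.
move=> mA [fi <-]; split; last by rewrite RintegralZl.
by have := integrableZl mA k fi; apply: eq_integrable.
Qed.

Lemma eq_has_integral (A : set R) f g c : measurable (A : set (measurableTypeR R)) -> {in A, f =1 g} ->
  has_integral A f c -> has_integral A g c.
Proof.
move=> mA fg [fi <-]; split; last exact/esym/eq_Rintegral.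
by apply: eq_integrable fi => // t tA; rewrite /= fg.
Qed.

(** Multiplying by [expR (- (th * t))] shifts [s] to [s + th], where the transform is still [c]. So
    each monomial in this exponential contributes [c] times its coefficient, in total [c *
    p.[1]]. *)
Lemma laplace_poly (f : R -> R) (b c th : R) : 0 <= th ->
  (forall s, b < s -> has_integral halfline (fun t => expR (- (s * t)) * f t) c) ->
  forall (p : {poly R}) s, b < s -> has_integral halfline
    (fun t => p.[expR (- (th * t))] * (expR (- (s * t)) * f t)) (c * p.[1]).
Proof.
move=> th0 fc p; elim/poly_ind: p => [|p k IH] s bs.
  rewrite horner0 mulr0; apply: (@eq_has_integral _ (fun=> 0)) => //.
    by move=> t _; rewrite horner0 mul0r.
  by split; [exact: integrable0|rewrite Rintegral_cst// mul0r].
have bs' : b < s + th by rewrite ltr_wpDr.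
have := has_integralD _ (IH _ bs') (has_integralZ k _ (fc s bs)).
move=> /(_ (measurable_itv _) (measurable_itv _)).
rewrite !hornerE mulrDr [c * k]mulrC; apply: eq_has_integral => // t _.
have -> : expR (- ((s + th) * t)) = expR (- (s * t)) * expR (- (th * t)).
  by rewrite -expRD; congr expR; ring.
by rewrite hornerD hornerM hornerX hornerC; ring.
Qed.

(** Kuhn's polynomials, known from an elementary proof of the Weierstrass approximation theorem;
    these bounds supply the domination for passing to the limit under the integral. *)
Lemma kuhn_poly_ge0_le1 (x : R) (n : nat) : 0 <= x <= 1 ->
  0 <= (1 - x ^+ n) ^+ (2 ^ n) <= 1.
Proof.
move=> /andP[x0 x1].
have y0 : 0 <= x ^+ n by rewrite exprn_ge0.
have y1 : x ^+ n <= 1 by rewrite exprn_ile1.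
by rewrite exprn_ge0 ?exprn_ile1 ?subr_ge0// lerBlDr lerDl.
Qed.

(* Bernoulli's inequality: [(1 - x^n)^(2^n) >= 1 - (2x)^n]. *)
Lemma kuhn_poly_cvg1 (x : R) : 0 <= x < 2^-1 ->
  (1 - x ^+ n) ^+ (2 ^ n) @[n --> \oo] --> (1 : R).
Proof.
move=> /andP[x0 x2].
have bern (y : R) n : 0 <= y <= 1 -> 1 - n%:R * y <= (1 - y) ^+ n.
  move=> /andP[y0 y1]; elim: n => [|n IH]; first by rewrite mul0r subr0 expr0.
  rewrite exprS; apply: le_trans (ler_wpM2l _ IH); last by rewrite subr_ge0.
  have n0 : 0 <= n%:R :> R by []. have := mulr_ge0 n0 (sqr_ge0 y).
  by rewrite -natr1; lra.
apply: (@squeeze_cvgr _ _ _ _ (fun n => 1 - (2 * x) ^+ n) (fun=> 1)).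
- near=> n; have x01 : 0 <= x <= 1 by rewrite x0/= ltW// (lt_trans x2)//; lra.
  have /andP[_ ->] := kuhn_poly_ge0_le1 n x01; rewrite andbT.
  apply: le_trans (bern _ _ _); first by rewrite exprMn natrX.
  by case/andP : x01 => *; rewrite exprn_ge0 ?exprn_ile1.
- rewrite -[X in _ --> X]subr0; apply: cvgB; first exact: cvg_cst.
  apply: cvg_expr; rewrite ger0_norm ?mulr_ge0//; lra.
- exact: cvg_cst.
Unshelve. all: by end_near. Qed.

(* [(1 - y)^m * (1 + m y) <= (1 - y)^m * (1 + y)^m <= 1] with [y = x^n], [m = 2^n]. *)
Lemma kuhn_poly_cvg0 (x : R) : 2^-1 < x <= 1 ->
  (1 - x ^+ n) ^+ (2 ^ n) @[n --> \oo] --> (0 : R).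
Proof.
move=> /andP[x2 x1].
have x0 : 0 < x by apply: lt_trans x2; rewrite invr_gt0.
have bern (y : R) n : 0 <= y -> 1 + n%:R * y <= (1 + y) ^+ n.
  move=> y0; elim: n => [|n IH]; first by rewrite mul0r addr0 expr0.
  rewrite exprS; apply: le_trans (ler_wpM2l _ IH); last by rewrite addr_ge0.
  have n0 : 0 <= n%:R :> R by []. have := mulr_ge0 n0 (sqr_ge0 y).
  by rewrite -natr1; lra.
apply: (@squeeze_cvgr _ _ _ _ (fun=> 0) (fun n => ((2 * x)^-1) ^+ n)).
- near=> n; have x01 : 0 <= x <= 1 by rewrite x1 ltW.
  have /andP[k0 _] := kuhn_poly_ge0_le1 n x01; rewrite k0/= exprVn.
  have p0 : 0 < (2 * x) ^+ n by rewrite exprn_gt0// mulr_gt0.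
  rewrite -[leRHS]mul1r ler_pdivlMr//.
  have y0 : 0 <= x ^+ n by rewrite exprn_ge0// ltW.
  apply: (@le_trans _ _ ((1 - x ^+ n) ^+ (2 ^ n) * (1 + x ^+ n) ^+ (2 ^ n))).
    apply: ler_wpM2l => //; apply: le_trans (bern _ _ y0).
    by rewrite natrX -exprMn lerDr.
  have y1 : x ^+ n <= 1 by rewrite exprn_ile1// ltW.
  rewrite -exprMn exprn_ile1//; first by apply: mulr_ge0; lra.
  have := sqr_ge0 (x ^+ n); lra.
- exact: cvg_cst.
- apply: cvg_expr; rewrite ger0_norm ?invr_ge0 ?mulr_ge0 ?ltW//.
  by rewrite invf_lt1 ?mulr_gt0//; move: x2; lra.
Unshelve. all: by end_near. Qed.

(* With [x t = 2^(- t / tau)], the polynomials [(1 - x^n)^(2^n)] in [x] tend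
   boundedly to the indicator of [t > tau], and they vanish at [x = 1]. *)
Lemma laplace_const_tail (f : R -> R) (b c s tau : R) : b < s -> 0 < tau ->
  (forall s, b < s -> has_integral halfline (fun t => expR (- (s * t)) * f t) c) ->
  Rintegral mu `]tau, +oo[ (fun t => expR (- (s * t)) * f t) = 0.
Proof.
move=> bs tau0 fc; pose h t := expR (- (s * t)) * f t.
(* Chosen so that [t = tau] corresponds to [x = 1 / 2], the jump of the limit. *)
pose th := ln 2 / tau; have th0 : 0 < th by rewrite divr_gt0// ln_gt0// ltr1n.
pose x t : R := expR (- (th * t)).
have xtau : x tau = 2^-1 by rewrite /x /th divfK ?gt_eqF// expRN lnK ?posrE.
pose p n : {poly R} := (1 - 'X^n) ^+ (2 ^ n).
have pE n y : (p n).[y] = (1 - y ^+ n) ^+ (2 ^ n) by rewrite /p !hornerE.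
have [hi _] := fc s bs.
have mh : measurable_fun halfline h by move/integrableP : hi => -[/measurable_EFinP].
have pI n := laplace_poly (ltW th0) fc (p n.+1) bs.
have x01 t : halfline t -> 0 <= x t <= 1.
  rewrite /= in_itv/= andbT => t0.
  by rewrite expR_ge0 -expR0 ler_expR oppr_le0 mulr_ge0// ltW.
have [] := @dominated_convergence _ _ _ mu halfline (measurable_itv _)
  (fun n t => ((p n.+1).[x t] * h t)%:E) (EFin \o (h \_ `]tau, +oo[))
  (EFin \o (fun t => `|h t|)).
- by move=> n; case: (pI n) => /integrableP[].
- apply/measurable_EFinP; apply/measurable_restrict => //.
  by apply: measurable_funS mh => // t [].
(* Pointwise convergence to the indicator is claimed off the null set [t = tau]. *)
- exists [set tau]; split => //=; first by rewrite lebesgue_measure_set1.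
  move=> t /=; apply: contra_notP => /eqP ttau t0; apply: cvg_EFin; first exact: nearW.
  have /andP[xt0 xt1] := x01 _ t0.
  rewrite (_ : _ \o _ = fun n => (1 - x t ^+ n.+1) ^+ (2 ^ n.+1) * h t); last first.
    by apply/funext => n /=; rewrite pE.
  rewrite (_ : (h \_ _) t = (tau < t)%R%:R * h t); last first.
    by rewrite patchE mem_setE in_itv/= andbT; case: (tau < t); rewrite ?mul1r ?mul0r.
  apply: cvgM; last exact: cvg_cst.
  rewrite (cvg_shiftS (fun n => (1 - x t ^+ n) ^+ (2 ^ n))).
  case: ltgtP ttau => // [taut|ttau] _.
    by apply: kuhn_poly_cvg1; rewrite xt0 -xtau ltr_expR ltrN2 ltr_pM2l.
  by apply: kuhn_poly_cvg0; rewrite xt1 -xtau ltr_expR ltrN2 ltr_pM2l// ttau.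
- by have := integrable_abse hi; apply: eq_integrable.
- apply/aeW => t n t0 /=; rewrite lee_fin normrM ler_piMl// pE.
  by have /andP[k0 k1] := kuhn_poly_ge0_le1 n.+1 (x01 _ t0); rewrite ger0_norm.
move=> _ _.
(* Each integral equals [c] times the value of the polynomial at 1, which is 0; hence so is the
   limit. *)
rewrite (_ : [sequence _]_n = fun=> 0%E); last first.
  apply/funext => n; rewrite /=; case: (pI n) => pi.
  rewrite pE expr1n subrr expr0n expn_eq0/= mulr0 /Rintegral => /eqP.
  rewrite fine_eq0 => [/eqP//|]; exact: integrable_fin_num.
move=> /(cvg_lim (@ereal_hausdorff R)); rewrite lim_cst; last exact: ereal_hausdorff.
move=> h0; have -> : `]tau, +oo[%classic = halfline `&` `]tau, +oo[.
  apply/seteqP; split => t /=; rewrite !in_itv/= !andbT; last by case.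
  by move=> tt; split => //; rewrite ltW// (lt_trans tau0).
by rewrite Rintegral_mkcondr /Rintegral -h0.
Qed.

(** A constant is the transform of an impulse at 0, invisible for [t > 0]. All tails of
    [expR (- (s * t)) * f t] integrate to zero, so its primitive is locally constant and the
    fundamental theorem of calculus gives [f t = 0]. *)
Lemma laplace_const_eq0 (f : R -> R) (b c : R) :
  (forall t, 0 < t -> {for t, continuous f}) ->
  (forall s, b < s -> has_integral halfline (fun t => expR (- (s * t)) * f t) c) ->
  forall t, 0 < t -> f t = 0.
Proof.
move=> cf fc t t0; pose s := b + 1; have bs : b < s by rewrite ltrDl.
pose h t := expR (- (s * t)) * f t.
have tail tau := @laplace_const_tail f b c s tau bs ^~ fc.
have [hi _] := fc s bs.
(* A base point strictly between 0 and [t]: the tail lemma requires a positive endpoint. *)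
have a0 : 0 < t / 2 by rewrite divr_gt0.
have hia : mu.-integrable `[t / 2, +oo[ (EFin \o h).
  by apply: integrableS hi => //; apply: subset_itvr; rewrite bnd_simp ltW.
have [] := @continuous_FTC1_closed R h (t / 2) t (t + 1).
- by rewrite ltrDl.
- by apply: integrableS hia => //; exact: subset_itvl.
- by rewrite ltr_pdivrMr// ltr_pMr// ltr1n.
- apply: continuousM; last exact: cf.
  apply: continuous_comp; last exact: continuous_expR.
  by apply: continuousN; apply: continuousM; [exact: cst_continuous|].
move=> _; rewrite derive1E (@near_eq_derive _ _ _ _ (cst 0)).
- by rewrite derive_cst => /esym/eqP; rewrite mulf_eq0 gt_eqF ?expR_gt0//= => /eqP.
near=> u; have tu : t / 2 < u.
  near: u; apply: lt_nbhsr; by rewrite ltr_pdivrMr// ltr_pMr// ltr1n.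
have := Rintegral_itvB hia (x := u); rewrite !bnd_simp (ltW tu) => /(_ isT isT).
have -> : \int[mu]_(v in `[t / 2, +oo[) h v = 0.
  rewrite -Rintegral_itv_obnd_cbnd ?tail//.
  by apply: integrableS hia => //; apply: subset_itvr; rewrite bnd_simp.
by rewrite (tail u (lt_trans a0 tu)) => /eqP; rewrite sub0r oppr_eq0 => /eqP.
Unshelve. all: by end_near. Qed.

End LaplaceUniqueness.

(** * Inverse transforms of stable rational functions *)

Section InverseTransform.
Context {R : realType}.
Notation mu := (@lebesgue_measure R).
Local Notation halfline := (`[0%R, +oo[%classic : set R).
Local Notation C := R[i]%type.
Local Notation Re := complex.Re.
Local Notation Im := complex.Im.

Lemma vanishing_bounded (f : R -> R) : continuous f ->
  f t @[t --> +oo] --> 0 -> exists c, forall t, 0 <= t -> `|f t| <= c.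
Proof.
move=> cf /cvgr0Pnorm_lt /(_ _ ltr01)[T [_ fT]].
have [c _ fc] : exists2 c, c \in `[0, `|T|]%R &
    forall t, t \in `[0, `|T|]%R -> `|f t| <= `|f c|.
  apply: (@EVT_max _ (fun t => `|f t|)) => //.
  by apply: continuous_subspaceT => t; apply: cvg_norm; exact: cf.
exists (`|f c| + 1) => t t0; have [tT|Tt] := leP t `|T|.
  by apply: le_trans (fc t _) _; rewrite ?lerDl// in_itv/= t0.
apply: le_trans (ltW (fT t _)) _; first exact: le_lt_trans (ler_norm _) Tt.
by rewrite lerDr.
Qed.

Lemma continuous_mul (f g : R -> R) : continuous f -> continuous g ->
  continuous (fun t => f t * g t).
Proof. by move=> cf cg t; exact: continuousM (cf t) (cg t). Qed.

Lemma continuous_add (f g : R -> R) : continuous f -> continuous g ->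
  continuous (fun t => f t + g t).
Proof. by move=> cf cg t; exact: continuousD (cf t) (cg t). Qed.

Lemma continuous_scale (k : R) (f : R -> R) : continuous f ->
  continuous (fun t => k * f t).
Proof. by apply: continuous_mul => t; exact: cst_continuous. Qed.

Lemma continuous_expRM (k : R) : continuous (fun t : R => expR (- (k * t))).
Proof.
move=> t; apply: continuous_comp; last exact: continuous_expR.
by apply: continuousN; apply: continuousM; [exact: cst_continuous|].
Qed.

(* Adding the dominating exponential reduces to the nonnegative case. *)
Lemma has_integral_derivative (F f : R -> R) (c s : R) : 0 < s ->
  (forall t : R, is_derive t 1 F (f t)) -> continuous f ->
  F t @[t --> +oo] --> 0 ->
  (forall t, 0 <= t -> `|f t| <= c * expR (- (s * t))) ->
  has_integral halfline f (- F 0).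
Proof.
move=> s0 dF cf F0 fc.
have ftc (G g : R -> R) : (forall t : R, is_derive t 1 G (g t)) -> continuous g ->
    G t @[t --> +oo] --> 0 -> (forall t, 0 <= t -> 0 <= g t) ->
    has_integral halfline g (- G 0).
  move=> dG cg G0 g0.
  have H : (\int[mu]_(x in halfline) (g x)%:E = 0%:E - (G 0)%:E)%E.
    apply: ge0_continuous_FTC2y => //.
    - exact: continuous_subspaceT.
    - apply: cvg_at_right_filter; apply: differentiable_continuous.
      by apply/derivable1_diffP; exact: ex_derive.
    - by move=> t _; rewrite derive1E; exact: derive_val.
  split; last by rewrite /Rintegral H/= sub0r.
  apply/integrableP; split.
    apply/measurable_EFinP; apply: measurable_funTS.
    exact: continuous_measurable_fun.
  rewrite (_ : (\int[mu]_(x in _) _)%E = (\int[mu]_(x in halfline) (g x)%:E)%E).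
    by rewrite H ltry.
  apply: eq_integral => t; rewrite inE/= in_itv/= andbT => t0.
  by rewrite ger0_norm ?g0.
have dE (t : R) : is_derive t 1 (fun t => - (c / s) * expR (- (s * t)))
    (c * expR (- (s * t))).
  apply: is_derive_eq; rewrite /GRing.scale/=; field; exact: lt0r_neq0.
have E0 : - (c / s) * expR (- (s * t)) @[t --> +oo] --> 0.
  by rewrite -(mulr0 (- (c / s))); apply: cvgM; [exact: cvg_cst|exact: cvg_expRN].
have cE : continuous (fun t : R => c * expR (- (s * t))).
  by apply: continuous_scale; exact: continuous_expRM.
have c0 : 0 <= c.
  have := fc 0 (lexx _); rewrite mulr0 oppr0 expR0 mulr1; exact: le_trans.
have iE := ftc _ _ dE cE E0 (fun t _ => mulr_ge0 c0 (expR_ge0 _)).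
have iS : has_integral halfline (fun t => f t + c * expR (- (s * t)))
    (- (F 0 + - (c / s) * expR (- (s * 0)))).
  apply: (ftc (fun t => F t + - (c / s) * expR (- (s * t)))).
  - exact: continuous_add.
  - by rewrite -(addr0 0); apply: cvgD.
  - by move=> t t0; have := fc t t0; rewrite ler_norml => /andP[]; lra.
have := has_integralD (measurable_itv _) iS (has_integralZ (- 1) (measurable_itv _) iE).
rewrite opprD mulN1r opprK subrK; apply: eq_has_integral => // t _; ring.
Qed.

Definition ccontinuous (w : R -> C) : Prop :=
  continuous (fun t => Re (w t)) /\ continuous (fun t => Im (w t)).

Definition has_cintegral (w : R -> C) (c : C) : Prop :=
  has_integral halfline (fun t => Re (w t)) (Re c) /\
  has_integral halfline (fun t => Im (w t)) (Im c).

Lemma ccontinuousD (v w : R -> C) : ccontinuous v -> ccontinuous w ->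
  ccontinuous (fun t => v t + w t).
Proof.
move=> [v1 v2] [w1 w2]; split.
  by under eq_fun do rewrite ReD; exact: continuous_add.
by under eq_fun do rewrite ImD; exact: continuous_add.
Qed.

Lemma ccontinuousZ (c : C) (w : R -> C) : ccontinuous w ->
  ccontinuous (fun t => c * w t).
Proof.
move=> [w1 w2]; have cZ (a b : R) : continuous (fun t => a * Re (w t) + b * Im (w t)).
  by apply: continuous_add; exact: continuous_scale.
split.
  by under eq_fun do rewrite ReM -mulNr; exact: cZ.
by under eq_fun do rewrite ImM addrC; exact: cZ.
Qed.

Lemma has_cintegralD (v w : R -> C) c d : has_cintegral v c ->
  has_cintegral w d -> has_cintegral (fun t => v t + w t) (c + d).
Proof.
move=> [v1 v2] [w1 w2]; split.
  rewrite ReD; apply: eq_has_integral (has_integralD _ v1 w1) => // t _.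
  by rewrite ReD.
rewrite ImD; apply: eq_has_integral (has_integralD _ v2 w2) => // t _.
by rewrite ImD.
Qed.

Lemma has_cintegralZ (k : C) (w : R -> C) c : has_cintegral w c ->
  has_cintegral (fun t => k * w t) (k * c).
Proof.
move=> [w1 w2].
have H a b := has_integralD (measurable_itv _)
  (has_integralZ a (measurable_itv _) w1) (has_integralZ b (measurable_itv _) w2).
split.
  rewrite ReM -mulNr; apply: eq_has_integral (H _ _) => // t _.
  by rewrite ReM mulNr.
rewrite ImM addrC; apply: eq_has_integral (H _ _) => // t _.
by rewrite ImM addrC.
Qed.

Lemma is_cderive_continuous (w dw : R -> C) :
  (forall t, is_cderive w t (dw t)) -> ccontinuous w.
Proof.
move=> dW; split => t; apply: differentiable_continuous; apply/derivable1_diffP;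
  have [? ?] := dW t; exact: ex_derive.
Qed.

(** The rule for the transform of a derivative: the integrand is the derivative of [e^(- s t) g].
    The factor [dg - s g] is continuous and vanishes at infinity, hence is bounded, which gives the
    exponential domination. *)
Lemma has_cintegral_derivative (g dg : R -> C) (s : R) : 0 < s ->
  (forall t, is_cderive g t (dg t)) -> ccontinuous dg ->
  vanishes g -> vanishes dg ->
  has_cintegral (fun t => (expR (- (s * t)))%:C%C * (dg t - s%:C%C * g t)) (- g 0).
Proof.
move=> s0 dg_ cdg g0 dg0.
have cg := is_cderive_continuous dg_.
have E0 : expR (- (s * t)) @[t --> +oo] --> 0 by exact: cvg_expRN.
suff H (p q : R -> R) : (forall t : R, is_derive t 1 p (q t)) -> continuous p ->
    continuous q -> p t @[t --> +oo] --> 0 -> q t @[t --> +oo] --> 0 ->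
    has_integral halfline (fun t => expR (- (s * t)) * (q t - s * p t)) (- p 0).
  case: cg cdg g0 dg0 => cg1 cg2 [cdg1 cdg2] [g01 g02] [dg01 dg02]; split.
    have := H _ _ (fun t => (dg_ t).1) cg1 cdg1 g01 dg01.
    rewrite ReN.
    apply: eq_has_integral => // t _.
    by rewrite ReM ReD ReN ReM /=; ring.
  have := H _ _ (fun t => (dg_ t).2) cg2 cdg2 g02 dg02.
  rewrite ImN.
  apply: eq_has_integral => // t _.
  by rewrite ImM ImD ImN ImM /=; ring.
move=> dp cp cq p0 q0.
have ck : continuous (fun t => q t - s * p t).
  under eq_fun do rewrite -mulNr.
  by apply: continuous_add => //; exact: continuous_scale.
have k0 : q t - s * p t @[t --> +oo] --> 0.
  rewrite (_ : 0 = 0 - s * 0); last by rewrite mulr0 subr0.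
  by apply: cvgB => //; apply: cvgM => //; exact: cvg_cst.
have [c kc] := vanishing_bounded ck k0.
have := @has_integral_derivative (fun t => expR (- (s * t)) * p t)
  (fun t => expR (- (s * t)) * (q t - s * p t)) c s s0.
rewrite mulr0 oppr0 expR0 mul1r; apply.
- by move=> t; have := dp t => ?; apply: is_derive_eq; rewrite /GRing.scale/=; ring.
- by apply: continuous_mul => //; exact: continuous_expRM.
- by rewrite -(mulr0 0); apply: cvgM.
- by move=> t t0; rewrite normrM ger0_norm ?expR_ge0// mulrC ler_wpM2r ?expR_ge0// kc.
Qed.

Definition has_transform (g G : R -> C) : Prop :=
  [/\ ccontinuous g, vanishes g & forall s, 0 < s ->
    has_cintegral (fun t => (expR (- (s * t)))%:C%C * g t) (G s)].

Lemma is_cderive_realM (f : R -> R) (w : R -> C) (t df : R) (dw : C) :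
  is_derive t 1 f df -> is_cderive w t dw ->
  is_cderive (fun r => (f r)%:C%C * w r) t (df%:C%C * w t + (f t)%:C%C * dw).
Proof.
move=> dff [w1 w2]; split.
  under eq_fun do rewrite ReM /= mul0r subr0.
  by apply: is_derive_eq; rewrite ReD !ReM /GRing.scale/=; ring.
under eq_fun do rewrite ImM /= mul0r addr0.
by apply: is_derive_eq; rewrite ImD !ImM /GRing.scale/=; ring.
Qed.

Definition cexp (l : C) (t : R) : C :=
  (expR (Re l * t) * cos (Im l * t) +i* (expR (Re l * t) * sin (Im l * t)))%C.

Lemma is_cderive_cexp (l : C) (t : R) : is_cderive (cexp l) t (l * cexp l t).
Proof.
by split; rewrite ?ReM ?ImM /=; apply: is_derive_eq; rewrite /GRing.scale/=; ring.
Qed.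

(** The factorial makes the derivative of the [m]-th function [l] times itself plus the previous
    one, and the transform a pure power. *)
Definition exp_monomial (l : C) (m : nat) (t : R) : C :=
  (t ^+ m / m`!%:R)%:C%C * cexp l t.

Lemma exp_monomial_derive (l : C) (m : nat) (t : R) :
  is_cderive (exp_monomial l m) t
    (l * exp_monomial l m t + if m is m'.+1 then exp_monomial l m' t else 0).
Proof.
have df : is_derive t 1 (fun r : R => r ^+ m / m`!%:R)
    (if m is m'.+1 then t ^+ m' / m'`!%:R else 0).
  case: m => [|m].
    under eq_fun do rewrite expr0; exact: is_derive_cst.
  rewrite (_ : (fun _ => _) = (m.+1)`!%:R^-1 \*: (id ^+ m.+1 : R -> R)).
    have dX := @is_deriveX R R id m.+1 t 1 1 (is_derive_id t 1).
    apply: (@is_derive_eq _ _ _ _ _ _ _ _ (@is_deriveZ _ _ _ _ _ _ _ _ dX)).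
    rewrite /GRing.scale/= factS natrM.
    have m0 : m`!%:R != 0 :> R by rewrite pnatr_eq0 -lt0n fact_gt0.
    have m1 : m.+1%:R != 0 :> R by rewrite pnatr_eq0.
    by field; rewrite ?nat1r ?m0 ?m1.
  by apply/funext => r; rewrite /= exprfctE mulrC.
have := is_cderive_realM df (is_cderive_cexp l t); rewrite /exp_monomial.
by case: (m) => [|m']; rewrite ?rmorph0 ?mul0r mulrCA addrC.
Qed.

(** Write [e_m] for the function and [T_m] for its transform. The derivative rule gives
    [(l - s) T_m + T_(m-1) = - e_m(0)], where [T_(-1) = 0], [e_0(0) = 1] and [e_m(0) = 0] for
    [m > 0]. Decay comes from the same recursion, with [e_(m-1)] as forcing. *)
Lemma exp_monomial_transform (l : C) (m : nat) : Re l < 0 ->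
  has_transform (exp_monomial l m) (fun s => (s%:C%C - l)^-1 ^+ m.+1).
Proof.
move=> l0; have sl (s : R) : 0 < s -> l - s%:C%C != 0.
  move=> s0; apply: contraTneq s0 => /eqP; rewrite subr_eq0 => /eqP sE.
  by move: l0; rewrite sE/= -leNgt => /ltW.
elim: m => [|m [cm vm IH]].
  have dg := exp_monomial_derive l 0.
  have cg := is_cderive_continuous dg.
  have vg : vanishes (exp_monomial l 0).
    apply: (vanishes_ode l0 (fun t _ => dg t)).
    by split => /=; exact: cvg_cst.
  split => // s s0.
  have := @has_cintegral_derivative (exp_monomial l 0)
    (fun t => l * exp_monomial l 0 t) s s0.
  have dg' t : is_cderive (exp_monomial l 0) t (l * exp_monomial l 0 t).
    by have := dg t; rewrite addr0.
  move=> /(_ dg' (ccontinuousZ l cg) vg (vanishesZ l vg)).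
  move=> /(has_cintegralZ (l - s%:C%C)^-1).
  rewrite (_ : exp_monomial l 0 0 = 1); last first.
    rewrite /exp_monomial /cexp expr0 divr1 !mulr0 expR0 cos0 sin0 mulr0 mulr1.
    by rewrite complexr0 !rmorph1 mulr1.
  rewrite mulrN1 -invrN opprB expr1 => -[h1 h2]; split.
    apply: eq_has_integral h1 => // t _; congr complex.Re.
    by field; exact: sl.
  apply: eq_has_integral h2 => // t _; congr complex.Im.
  by field; exact: sl.
have dg := exp_monomial_derive l m.+1.
have cg := is_cderive_continuous dg.
have vg : vanishes (exp_monomial l m.+1) by exact: (vanishes_ode l0 (fun t _ => dg t)).
split => // s s0.
have := has_cintegral_derivative s0 dg (ccontinuousD (ccontinuousZ l cg) cm) vg
  (vanishesD (vanishesZ l vg) vm).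
move=> /has_cintegralD - /(_ _ _ (has_cintegralZ (- 1) (IH s s0))).
move=> /(has_cintegralZ (l - s%:C%C)^-1).
rewrite (_ : exp_monomial l m.+1 0 = 0); last first.
  by rewrite /exp_monomial expr0n/= !mul0r.
rewrite oppr0 add0r mulN1r mulrN -mulNr -invrN opprB -exprS => -[h1 h2]; split.
  apply: eq_has_integral h1 => // t _; congr complex.Re.
  by field; exact: sl.
apply: eq_has_integral h2 => // t _; congr complex.Im.
by field; exact: sl.
Qed.

End InverseTransform.

Section PartialFractions.
Context {R : realType}.
Notation mu := (@lebesgue_measure R).
Local Notation halfline := (`[0%R, +oo[%classic : set R).
Local Notation C := R[i]%type.
Local Notation Re := complex.Re.
Local Notation Im := complex.Im.

(** Finite sums of terms [c / (s - l)^(m+1)], with equality required only for [s > 0], where no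
    denominator vanishes. *)
Inductive partial_fraction : (R -> C) -> Prop :=
| partial_fraction0 G : (forall s, 0 < s -> G s = 0) -> partial_fraction G
| partial_fractionS (c l : C) (m : nat) G H : Re l < 0 -> partial_fraction H ->
    (forall s, 0 < s -> G s = c * (s%:C%C - l)^-1 ^+ m.+1 + H s) ->
    partial_fraction G.

Lemma stable_sub_neq0 (l : C) (s : R) : Re l < 0 -> 0 < s -> s%:C%C - l != 0.
Proof.
move=> l0; apply: contraTneq => /eqP; rewrite subr_eq0 => /eqP sE.
by move: l0; rewrite -sE/= -leNgt => /ltW.
Qed.

Lemma partial_fractionD G H : partial_fraction G -> partial_fraction H ->
  partial_fraction (fun s => G s + H s).
Proof.
move=> pG; elim: pG H => [{}G G0|c l m {}G K l0 _ IH GE] H.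
  elim=> [{}H H0|c l m {}H K l0 pK _ HE].
    by apply: partial_fraction0 => s s0; rewrite (G0 s s0) (H0 s s0) addr0.
  by apply: (partial_fractionS l0 pK) => s s0; rewrite (G0 s s0) add0r; exact: HE.
move=> /IH pKH; apply: (partial_fractionS l0 pKH) => s s0.
by rewrite (GE s s0) addrA.
Qed.

Lemma partial_fraction_ext G H : (forall s, 0 < s -> H s = G s) ->
  partial_fraction G -> partial_fraction H.
Proof.
move=> HG pG; case: pG HG => [{}G G0|c l m {}G K l0 pK GE] HG.
  by apply: partial_fraction0 => s s0; rewrite (HG s s0) (G0 s s0).
by apply: (partial_fractionS l0 pK) => s s0; rewrite (HG s s0) (GE s s0).
Qed.

Lemma partial_fractionZ (k : C) G : partial_fraction G ->
  partial_fraction (fun s => k * G s).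
Proof.
elim=> [{}G G0|c l m {}G K l0 _ IH GE].
  by apply: partial_fraction0 => s s0; rewrite (G0 s s0) mulr0.
by apply: (partial_fractionS l0 IH) => s s0; rewrite (GE s s0) mulrDr mulrA.
Qed.

Lemma partial_fraction1 (l : C) (m : nat) : Re l < 0 ->
  partial_fraction (fun s => (s%:C%C - l)^-1 ^+ m.+1).
Proof.
move=> l0; apply: (@partial_fractionS 1 l m _ (fun=> 0)) => //.
  exact: partial_fraction0.
by move=> s _; rewrite mul1r addr0.
Qed.

(* For [m != l], with [x = 1 / (s - m)] and [y = 1 / (s - l)], [x y = (x - y) / (m - l)]. *)
Lemma partial_fraction_div (l : C) G : Re l < 0 -> partial_fraction G ->
  partial_fraction (fun s => G s * (s%:C%C - l)^-1).
Proof.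
move=> l0; elim=> [{}G G0|c m k {}G K m0 _ IH GE].
  by apply: partial_fraction0 => s s0; rewrite (G0 s s0) mul0r.
suff H : partial_fraction (fun s => (s%:C%C - m)^-1 ^+ k.+1 * (s%:C%C - l)^-1).
  apply: partial_fraction_ext (partial_fractionD (partial_fractionZ c H) IH).
  by move=> s s0; rewrite (GE s s0) mulrDl mulrA mulrAC.
have [<-|ml] := eqVneq m l.
  apply: partial_fraction_ext (partial_fraction1 k.+1 m0) => s s0.
  by rewrite [RHS]exprSr.
(* Induction on the power of [x], starting from 0: [x^(j+1) y = (x^(j+1) - x^j y) / (m - l)]. *)
elim: k.+1 => [|j IHj].
  apply: partial_fraction_ext (partial_fraction1 0 l0) => s s0.
  by rewrite expr0 mul1r expr1.
have := partial_fractionD (partial_fraction1 j m0) (partial_fractionZ (- 1) IHj).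
move=> /(partial_fractionZ (m - l)^-1); apply: partial_fraction_ext => s s0.
have sl := stable_sub_neq0 l0 s0; have sm := stable_sub_neq0 m0 s0.
have ml0 : m - l != 0 by rewrite subr_eq0.
by rewrite exprS; field; rewrite ml0 sl sm.
Qed.

(** Peel off a root by [r = q (X - l) + r(l)]: the first term cancels the factor [s - l] and falls
    under the induction hypothesis, the second leaves a constant numerator. With no root left, the
    size bound forces [r = 0]. *)
Lemma partial_fraction_prod (rs : seq C) (r : {poly C}) :
  (forall l, l \in rs -> Re l < 0) -> (size r <= size rs)%N ->
  partial_fraction (fun s => r.[s%:C%C] / \prod_(l <- rs) (s%:C%C - l)).
Proof.
elim: rs r => [|l rs IH] r rs0 sr.
  apply: partial_fraction0 => s _.
  by move: sr; rewrite leqn0 size_poly_eq0 => /eqP->; rewrite horner0 mul0r.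
have l0 : Re l < 0 by apply: rs0; rewrite mem_head.
have {}rs0 m : m \in rs -> Re m < 0 by move=> mrs; apply: rs0; rewrite in_cons mrs orbT.
(* A constant has size at most 1, so the induction hypothesis covers it only if [rs] is nonempty; a
   single root is treated directly. *)
have const c : partial_fraction (fun s => c / \prod_(m <- l :: rs) (s%:C%C - m)).
  case: rs {sr} => [|m rs] in IH rs0 *.
    apply: partial_fraction_ext (partial_fractionZ c (partial_fraction1 0 l0)).
    by move=> s _; rewrite big_seq1 expr1.
  have sc : (size c%:P <= size (m :: rs))%N by rewrite (leq_trans (size_polyC_leq1 _)).
  apply: partial_fraction_ext (partial_fraction_div l0 (IH c%:P rs0 sc)) => s s0.
  by rewrite hornerC [in LHS]big_cons invfM; ring.
have /factor_theorem[q qE] : root (r - r.[l]%:P) l.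
  by rewrite /root !hornerE subrr.
have sq : (size q <= size rs)%N.
  have [->|q0] := eqVneq q 0; first by rewrite size_poly0.
  rewrite -ltnS -[X in (_ < X)%N]/(size (l :: rs)).
  have : (size (r - r.[l]%:P)%R <= size (l :: rs))%N.
    rewrite (leq_trans (size_polyD _ _))// geq_max sr size_polyN.
    by rewrite (leq_trans (size_polyC_leq1 _)).
  by rewrite qE size_Mmonic ?monicXsubC// size_XsubC addn2.
apply: partial_fraction_ext (partial_fractionD (IH q rs0 sq) (const r.[l])) => s s0.
have -> : r.[s%:C%C] = q.[s%:C%C] * (s%:C%C - l) + r.[l].
  by have := congr1 (fun p => p.[s%:C%C]) qE; rewrite /= !hornerE => <-; ring.
rewrite !big_cons mulrDl invfM; congr (_ + _).
by rewrite mulrA mulfK// stable_sub_neq0.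
Qed.

Lemma partial_fraction_transform G : partial_fraction G ->
  exists g, has_transform g G.
Proof.
elim=> [{}G G0|c l m {}G K l0 _ [k [ck vk kK]] GE].
  exists (fun=> 0); split; first by split => t; exact: cst_continuous.
    by split; exact: cvg_cst.
  move=> s s0; rewrite (G0 s s0).
  have z : has_integral halfline (fun=> 0) 0.
    by split; [exact: integrable0|rewrite Rintegral_cst// mul0r].
  by split; apply: eq_has_integral z => // t _; rewrite mulr0.
have [ce ve eE] := exp_monomial_transform m l0.
exists (fun t => c * exp_monomial l m t + k t); split.
- exact: ccontinuousD (ccontinuousZ c ce) ck.
- exact: vanishesD (vanishesZ c ve) vk.
- move=> s s0; rewrite (GE s s0).
  have [h1 h2] := has_cintegralD (has_cintegralZ c (eE s s0)) (kK s s0).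
  split; [apply: eq_has_integral h1|apply: eq_has_integral h2] => // t _;
    by congr (_ _); ring.
Qed.

(** By properness the polynomial quotient is a constant [k], the impulsive part; the remainder over
    the split denominator is a sum of stable partial fractions. *)
Lemma stable_fraction_expansion (p q : {poly R}) : coprimep p q ->
  (size p <= size q)%N ->
  (forall s : C, root (complex_poly q) s -> Re s < 0) ->
  exists k G, partial_fraction G /\ forall s : R, 0 < s ->
    (complex_poly p).[s%:C%C] / (complex_poly q).[s%:C%C] = k + G s.
Proof.
move=> pq spq stable.
(* If [q = 0], properness gives [p = 0], and 0 is not coprime to itself. *)
have q0 : q != 0.
  apply: contraTneq pq => q0; move: spq; rewrite q0 size_poly0 leqn0 size_poly_eq0.
  by move=> /eqP->; rewrite coprimep0 eqp_sym; apply/negP => /eqp_size; rewrite size_poly0 size_poly1.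
set P := complex_poly p; set Q := complex_poly q.
have sQ : size Q = size q by rewrite size_map_poly.
have sP : size P = size p by rewrite size_map_poly.
have Q0 : Q != 0 by rewrite -size_poly_eq0 sQ size_poly_eq0.
have [rs QE] := closed_field_poly_normal Q.
have lQ : lead_coef Q != 0 by rewrite lead_coef_eq0.
have srs : size Q = (size rs).+1 by rewrite QE size_scale// size_prod_XsubC.
have rs0 l : l \in rs -> Re l < 0.
  by move=> lrs; apply: stable; rewrite -/Q QE rootZ// root_prod_XsubC.
have sd : (size (P %/ Q)%R <= 1)%N.
  by rewrite size_divp// leq_subLR sP sQ addn1 prednK// size_poly_gt0.
have sr : (size (P %% Q)%R <= size rs)%N by rewrite -ltnS -srs ltn_modp.
exists (P %/ Q)`_0, (fun s => (lead_coef Q)^-1 *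
  ((P %% Q).[s%:C%C] / \prod_(l <- rs) (s%:C%C - l))); split.
  have H := partial_fraction_prod rs0 sr.
  exact: partial_fractionZ H.
move=> s s0.
have Qs : Q.[s%:C%C] = lead_coef Q * \prod_(l <- rs) (s%:C%C - l).
  rewrite {1}QE hornerZ horner_prod; congr (_ * _).
  by apply: eq_bigr => l _; rewrite !hornerE.
have Qs0 : Q.[s%:C%C] != 0.
  apply/negP => /stable/=; by rewrite ltNge ltW.
rewrite {1}(divp_eq P Q) (size1_polyC sd) hornerD hornerM hornerC mulrDl mulfK//.
by rewrite coefC eqxx Qs invfM mulrCA.
Qed.

Lemma stable_laplace_vanishes (p q : {poly R}) (d a : R) (u : R -> R) :
  coprimep p q -> (size p <= size q)%N ->
  (forall s : C, root (complex_poly q) s -> Re s < 0) ->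
  (forall t, 0 < t -> {for t, continuous u}) ->
  (forall s : R, a < s ->
     mu.-integrable halfline (fun t => (expR (- (s * t)) * u t)%:E)) ->
  (forall s : R, a < s -> 0 < s ->
     (complex_poly p).[s%:C%C] / (complex_poly q).[s%:C%C] =
       d%:C%C + laplace u s%:C%C) ->
  u t @[t --> +oo] --> 0.
Proof.
move=> pq spq stable cu ui uE.
have [k [G [pG GE]]] := stable_fraction_expansion pq spq stable.
have [g [cg vg gG]] := partial_fraction_transform pG.
(* Both transforms are available beyond [max a 0], and there the transform of [u - Re g] is the
   constant [Re k - d]. *)
have H := @laplace_const_eq0 R (fun t => u t - Re (g t)) (Num.max a 0) (Re k - d).
have {}H t : 0 < t -> u t = Re (g t).
  move=> t0; apply/eqP; rewrite -subr_eq0; apply/eqP; apply: H => // [r r0|s].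
    by apply: continuousB; [exact: cu|exact: cg.1].
  rewrite gt_max => /andP[sa s0].
  have [gi _] := gG s s0.
  have uI : has_integral halfline (fun t => expR (- (s * t)) * u t) (Re k + Re (G s) - d).
    split; first exact: ui.
    have := GE s s0; rewrite uE// => /(congr1 (@complex.Re R)); rewrite !ReD /=.
    move=> <-; rewrite addrC addKr; apply: eq_Rintegral => v _.
    by rewrite mul0r cos0 mulr1.
  have := has_integralD (measurable_itv _) uI (has_integralZ (- 1) (measurable_itv _) gi).
  rewrite (_ : _ + _ + - 1 * _ = Re k - d); last by ring.
  by apply: eq_has_integral => // v _; rewrite ReM/=; ring.
case: vg => vg _; apply: cvg_trans vg; apply: near_eq_cvg.
near=> t; rewrite H//; near: t; exact: nbhs_pinfty_gt.
Unshelve. all: by end_near. Qed.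

End PartialFractions.

(** * The serial consensus system *)

Section Serial.
Context {R : realType}.

(** The characteristic determinant of a block triangular matrix is the product of those of its
    diagonal blocks. *)
Lemma eigenvalue_ublock (F : fieldType) (m n : nat) (A : 'M[F]_m) (B : 'M[F]_(m, n))
    (D : 'M[F]_n) (l : F) :
  eigenvalue (block_mx A B 0 D) l = eigenvalue A l || eigenvalue D l.
Proof.
have detE k (M : 'M[F]_k) : eigenvalue M l = (\det (l%:M - M) == 0).
  apply/eigenvalueP/det0P => [[v vM v0]|[v v0]].
    by exists v => //; rewrite mulmxBr vM mul_mx_scalar subrr.
  rewrite mulmxBr mul_mx_scalar => /eqP; rewrite subr_eq0 => /eqP vM.
  by exists v.
rewrite !detE -mulf_eq0 scalar_mx_block opp_block_mx add_block_mx.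
by rewrite !sub0r oppr0 det_ublock.
Qed.

Lemma serial_poleE (N : nat) (L1 L2 : 'M[R]_N) z :
  serial_pole L1 L2 z = is_eigenvalue (- L1) z || is_eigenvalue (- L2) z.
Proof.
rewrite /serial_pole /is_eigenvalue /complex_mx /serial_state_matrix map_block_mx.
by rewrite map_mx0 eigenvalue_ublock.
Qed.

Lemma serial_consensus (N : nat) (W1 W2 L1 L2 : 'M[R]_N) (d x0 v0 : 'cV[R]_N)
    (u x : R -> 'cV[R]_N) :
  is_laplacian W1 L1 -> is_laplacian W2 L2 ->
  has_spanning_tree W1 -> has_spanning_tree W2 ->
  (forall i, u t i 0 @[t --> +oo] --> 0) ->
  serial_solution L1 L2 d u x0 v0 x -> second_order_consensus x.
Proof.
move=> LW1 LW2 tree1 tree2 u0 [dx ode _ _].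
pose xi t := dot x t + L1 *m x t.
have dxE (t : R) : 0 < t -> forall i, is_derive t 1 (fun r => x r i 0) (dot x t i 0).
  by move=> t0 i; rewrite mxE derive1E; apply/derivableP; exact: (dx t t0).1.
have ddxE (t : R) : 0 < t -> forall i,
    is_derive t 1 (fun r => dot x r i 0) (dot (dot x) t i 0).
  by move=> t0 i; rewrite [X in is_derive _ _ _ X]mxE derive1E; apply/derivableP; exact: (dx t t0).2.
have diff0 (f g : R -> R) : f t @[t --> +oo] --> 0 -> g t @[t --> +oo] --> 0 ->
    f t - g t @[t --> +oo] --> 0.
  by move=> f0 g0; have fg := cvgB f0 g0; rewrite subr0 in fg; exact: fg.
(* First stage: substituting the equation for [x''] gives [xi' = u - L2 xi]. *)
have xi0 : forall i j, xi t i 0 - xi t j 0 @[t --> +oo] --> 0.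
  apply: (relative_flow_vanishes (h := u) LW2 tree2) => [t t0 i|i j]; last exact: diff0.
  have dL : is_derive t 1 (fun r => (L1 *m x r) i 0) ((L1 *m dot x t) i 0).
    rewrite mxE (_ : (fun _ => _) = \sum_j (fun r => L1 i j * x r j 0)).
      apply: is_derive_sum => j; have := dxE t t0 j => ?.
      by apply: is_derive_eq; rewrite /GRing.scale/=; ring.
    by apply/funext => r; rewrite mxE fct_sumE.
  rewrite (_ : (fun _ => _) = fun r => dot x r i 0 + (L1 *m x r) i 0); last first.
    by apply/funext => r; rewrite mxE.
  have := ddxE t t0 i => ?; apply: is_derive_eq.
  by rewrite ode// /xi mulmxDl mulmxDr mulmxA !mxE; ring.
(* Second stage: [x' = xi - L1 x], driven by [xi]. *)
have x0_ : forall i j, x t i 0 - x t j 0 @[t --> +oo] --> 0.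
  apply: (relative_flow_vanishes (h := xi) LW1 tree1) => [t t0 i|//].
  have -> : (xi t - L1 *m x t) i 0 = dot x t i 0 by rewrite /xi addrK.
  exact: dxE.
(* [L1 x] is a weighted sum of position differences, so it vanishes; the velocity [xi - L1 x] then
   inherits consensus from [xi]. *)
have Lx0 i : (L1 *m x t) i 0 @[t --> +oo] --> 0.
  rewrite (funext (fun t => laplacian_sumE_real LW1 (x t) i)).
  have H0 : \sum_(k < N | k != i) (0 : R) = 0 by exact: big1.
  rewrite -[X in _ --> X]H0.
  apply: cvg_big; first exact: add_continuous.
  move=> k _; rewrite -(mulr0 (W1 i k)); apply: cvgM; first exact: cvg_cst.
  exact: x0_.
move=> i j; split; apply/norm_cvg0P; last exact: x0_.
have dE t : dot x t = xi t - L1 *m x t by rewrite /xi addrK.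
under eq_fun do rewrite !dE.
have := diff0 _ _ (xi0 i j) (diff0 _ _ (Lx0 i) (Lx0 j)).
rewrite (_ : (fun _ => _) = (fun t => (xi t - L1 *m x t) i 0 - (xi t - L1 *m x t) j 0)) //.
by apply/funext => t; rewrite !mxE; ring.
Qed.

End Serial.

Theorem theorem1 (R : realType) (N : nat) (W1 W2 L1 L2 : 'M[R]_N)
    (Uref : R[i] -> 'cV[R[i]]_N) :
  (0 < N)%N ->
  is_laplacian W1 L1 ->
  is_laplacian W2 L2 ->
  has_spanning_tree W1 ->
  has_spanning_tree W2 ->
  RHinf Uref ->
  (forall z : R[i],
     serial_pole L1 L2 z <-> is_eigenvalue (- L1) z \/ is_eigenvalue (- L2) z)
  /\
  (forall (d : 'cV[R]_N) (u : R -> 'cV[R]_N) (x0 v0 : 'cV[R]_N)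
     (x : R -> 'cV[R]_N),
     has_laplace_transform d u Uref ->
     serial_solution L1 L2 d u x0 v0 x ->
     second_order_consensus x).
Proof.
move=> _ LW1 LW2 tree1 tree2 UH; split=> [z|d u x0 v0 x ulap sol].
  by rewrite serial_poleE; split=> /orP.
apply: serial_consensus LW1 LW2 tree1 tree2 _ sol => i.
have [p [q [pq spq stable Uq]]] := UH i 0; have [cu [a Ua]] := ulap i.
apply: (stable_laplace_vanishes (d := d i 0) (a := a) pq spq stable cu).
  by move=> s sa; have [ui _] := Ua s%:C%C sa.
move=> s sa s0; have [_ <-] := Ua s%:C%C sa.
(* Stability keeps the roots of [q] off the positive real axis, so [Uref] equals [p / q] there. *)
rewrite Uq//; apply/negP => /stable/=.
by rewrite ltNge ltW.
Qed.
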